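(* Let $d\ge 1$, let $\{\xi(i,m)\}$ ($1\le i\le n$, $1\le m\le d$) be a family of centered martingale differences with respect to a common filtration $(F(i))$, as described in the context, and let $p\ge 4$ be such that $V_d(p)=\prod_{m=1}^d\mu_m(d\cdot p)<\infty$. Define the sequence $\gamma(d)$, $d=1,2,\dots$, by $$\gamma(1)=K_{Os},\qquad \gamma(d+1)=\gamma(d)\cdot K_{Os}\cdot\left(1+\frac1d\right)^d .$$ Then $$U(p;d,n)\;\le\;\gamma(d)\cdot\frac{p^d}{(\ln p)^d}\cdot V_d(p)\;=\;\gamma(d)\cdot\frac{p^d}{(\ln p)^d}\cdot\prod_{m=1}^d\mu_m(d\,p).$$
   Context: Setting. $(\Omega,F,\mathbf P)$ is a probability space with a filtration $F(0)=\{\emptyset,\Omega\}$, $F(i)\subset F(i+1)\subset F$. The real random variables $\xi(i,m)$, $i=1,2,\dots,n$ ($n\le\infty$), $m=1,\dots,d$, satisfy $\mathbf E|\xi(i,m)|<\infty$, $\mathbf E\xi(i,m)=0$, and, almost surely, $\mathbf E[\xi(i,m)\mid F(k)]=0$ for all $k=0,1,\dots,i-1$ and $\mathbf E[\xi(i,m)\mid F(i)]=\xi(i,m)$ (i.e. for each $m$ the sequence $\xi(\cdot,m)$ is a martingale difference sequence for the same filtration). Notation. $I(d,n)$ is the set of multi-indices $\vec i=(i_1,\dots,i_d)$ with $1\le i_1<i_2<\dots<i_d\le n$. For $\vec i\in I(d,n)$ put $\xi(\vec i)=\prod_{s=1}^d\xi(i_s,s)$. For a non-random real array $b=(b(\vec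 i))$, symmetric in its arguments, put $$Q(d,n,b)=\sum_{\vec i\in I(d,n)}b(\vec i)\,\xi(\vec i),$$ where for $n=\infty$ this means the almost sure limit as $n\to\infty$, if it exists. Put $\|b\|^2=\sum_{\vec i\in I(d,n)}b^2(\vec i)$, and let $B$ be the set of all $b$ with $\|b\|=1$. For a random variable $\eta$, $|\eta|_p=(\mathbf E|\eta|^p)^{1/p}$. Put $$U(p;d,n)=\sup_{b\in B}|Q(d,n,b)|_p,\qquad \mu_m(p)=\sup_i|\xi(i,m)|_p .$$ Osekowski's constant. Let $$Os(p)=4\sqrt2\left(\frac p4+1\right)^{1/p}\left(1+\frac{p}{\ln(p/2)}\right),\qquad K_{Os}=\sup_{p\ge4}\frac{Os(p)}{p/\ln p}\approx 15.7858 .$$ *)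

(* Defs.v *)
From HB Require Import structures.
From mathcomp Require Import all_boot all_order all_algebra perm.
From mathcomp Require Import all_classical all_reals all_analysis.
From mathcomp Require Import ring lra.

Set Implicit Arguments.
Unset Strict Implicit.
Unset Printing Implicit Defensive.

Import Order.TTheory GRing.Theory Num.Theory.
Import numFieldNormedType.Exports.

Local Open Scope classical_set_scope.
Local Open Scope ring_scope.

Section conditional_expectation.
Context {disp : measure_display} {T : measurableType disp} {R : realType}.
Variable P : probability T R.

(* Y is a version of E[X | G], for X integrable and G a sub-sigma-algebra. *)
Definition cond_exp_version (G : set_system T) (X Y : T -> R) : Prop :=
  [/\ forall A : set R, measurable A -> G (Y @^-1` A),
      P.-integrable setT (EFin \o Y) &
      forall A, G A -> (\int[P]_(w in A) (Y w)%:E = \int[P]_(w in A) (X w)%:E)%E].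

(* E[X | G] = Z almost surely; Z itself need not be G-measurable, since G is
   not assumed to contain the P-negligible sets. *)
Definition cond_exp_ae_eq (G : set_system T) (X Z : T -> R) : Prop :=
  exists2 Y, cond_exp_version G X Y & {ae P, forall w, Y w = Z w}.

End conditional_expectation.

Definition filtration {disp : measure_display} {T : measurableType disp}
    (F : nat -> set_system T) : Prop :=
  [/\ F 0%N = [set set0; setT],
      forall i, sigma_algebra setT (F i),
      forall i, F i `<=` F i.+1 &
      forall i, F i `<=` measurable].

(* The horizon n <= oo is an [option nat], with [None] standing for oo;
   times are 1-based, time 0 being that of the trivial sigma-algebra F 0. *)
Definition time_in (n : option nat) (i : nat) : bool :=
  (1 <= i)%N && (if n is Some N then (i <= N)%N else true).

Definition martingale_differences {disp : measure_display}
    {T : measurableType disp} {R : realType} (P : probability T R)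
    (F : nat -> set_system T) (n : option nat) (d : nat)
    (xi : nat -> 'I_d -> {RV P >-> R}) : Prop :=
  forall i m, time_in n i ->
  [/\ P.-integrable setT (EFin \o xi i m),
      ('E_P[xi i m] = 0)%E,
      forall k, (k < i)%N -> cond_exp_ae_eq P (F k) (xi i m) (cst 0) &
      cond_exp_ae_eq P (F i) (xi i m) (xi i m)].

Definition multi_index (d : nat) (n : option nat) : set {ffun 'I_d -> nat} :=
  [set i | (forall s, time_in n (i s)) /\
           (forall s t : 'I_d, (s < t)%N -> (i s < i t)%N)].
Arguments multi_index : clear implicits.

Section arrays.
Context {R : realType} (d : nat).
Implicit Type b : {ffun 'I_d -> nat} -> R.

Definition symmetric_array b : Prop :=
  forall (s : 'S_d) (i : {ffun 'I_d -> nat}), b [ffun k => i (s k)] = b i.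

Definition array_norm (n : option nat) b : \bar R :=
  ((\esum_(i in multi_index d n) ((b i) ^+ 2)%:E) `^ (2^-1))%E.

Definition unit_arrays (n : option nat) : set ({ffun 'I_d -> nat} -> R) :=
  [set b | symmetric_array b /\ array_norm n b = 1%E].

End arrays.

Section multilinear_forms.
Context {disp : measure_display} {T : measurableType disp} {R : realType}.
Variables (P : probability T R) (d : nat) (xi : nat -> 'I_d -> {RV P >-> R}).

Definition xi_prod (i : {ffun 'I_d -> nat}) (w : T) : R :=
  \prod_(s < d) xi (i s) s w.

Definition Qfin (N : nat) (b : {ffun 'I_d -> nat} -> R) (w : T) : R :=
  \sum_(i \in multi_index d (Some N)) b i * xi_prod i w.

(* q is (a version of) Q(d, n, b): for n = oo the almost sure limit of the
   finite sums is only determined up to a negligible set, and may fail to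
   exist. *)
Definition is_Q (n : option nat) (b : {ffun 'I_d -> nat} -> R)
    (q : {RV P >-> R}) : Prop :=
  if n is Some N then forall w, q w = Qfin N b w
  else {ae P, forall w, Qfin N b w @[N --> \oo] --> q w}.

(* U(p; d, n); for n = oo the supremum is over those b for which Q(d, oo, b)
   exists. *)
Definition U (p : R) (n : option nat) : \bar R :=
  ereal_sup [set x | exists b q,
    [/\ unit_arrays n b, is_Q n b q & x = 'N[P]_(p%:E)[EFin \o q]%E]].

Definition mu (n : option nat) (m : 'I_d) (p : R) : \bar R :=
  ereal_sup [set 'N[P]_(p%:E)[EFin \o xi i m]%E | i in [set i | time_in n i]].

Definition V (p : R) (n : option nat) : \bar R :=
  (\prod_(m < d) mu n m (d%:R * p)%R)%E.

End multilinear_forms.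

Section constants.
Context {R : realType}.

Definition Os (p : R) : R :=
  4 * Num.sqrt 2 * (p / 4 + 1) `^ (p^-1) * (1 + p / ln (p / 2)).

Definition K_Os : R := sup [set Os p / (p / ln p) | p in [set p : R | 4 <= p]].

(* The real-valued sup above is a genuine least upper bound. *)
Lemma has_sup_K_Os :
  has_sup [set Os p / (p / ln p) | p in [set p : R | 4 <= p]].
Proof.
split; first by exists (Os 4 / (4 / ln 4)), 4 => //=.
exists (4 * Num.sqrt 2 * expR 1 * 3) => _ [p /= p4 <-].
have lnp0 : 0 < ln p by apply: ln_gt0; lra.
have lnh0 : 0 < ln (p / 2) by apply: ln_gt0; lra.
have lnpp : ln p <= p by apply/ltW/ln_sublinear; lra.
have ln2 : ln p <= 2 * ln (p / 2).
  rewrite mulrC mulr_natr -lnXn; last lra.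
  rewrite ler_ln ?posrE ?exprn_gt0 //; nra.
have -> : Os p / (p / ln p) =
    4 * Num.sqrt 2 * (p / 4 + 1) `^ p^-1 * (ln p / p + ln p / ln (p / 2)).
  by rewrite /Os; field; rewrite !gt_eqF//; lra.
apply: ler_pM.
- by rewrite !mulr_ge0 ?powR_ge0 ?sqrtr_ge0.
- by rewrite addr_ge0// divr_ge0 ?ltW//; lra.
- apply: ler_wpM2l; first by rewrite mulr_ge0 ?sqrtr_ge0.
  rewrite /powR gt_eqF; last lra.
  rewrite ler_expR mulrC ler_pdivrMr ?mul1r; last lra.
  apply: le_trans lnpp; rewrite ler_ln ?posrE; lra.
- have h1 : ln p / p <= 1 by rewrite ler_pdivrMr ?mul1r; lra.
  have h2 : ln p / ln (p / 2) <= 2 by rewrite ler_pdivrMr.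
  lra.
Qed.

(* gamma 0 is irrelevant. *)
Fixpoint gamma (d : nat) : R :=
  match d with
  | 0 => 0
  | 1 => K_Os
  | k.+1 => gamma k * K_Os * (1 + k%:R^-1) ^+ k
  end.

End constants.

(* Main.v *)
Require Import Defs.
From mathcomp Require Import all_boot all_order all_algebra.
From mathcomp Require Import all_classical all_reals all_analysis.
From mathcomp Require Import measurable_realfun.
From mathcomp Require Import ring lra.

(** The theorem rests on a moment inequality for sums of orthogonal increments:
    if S and X are in L^p with p >= 4 and E[|S|^(p-2) S X] = 0, then
      |S + X|_p^2 <= |S|_p^2 + 4 p |X|_p^2
    (Lnorm_orthogonal_increment).  For a martingale difference X the
    orthogonality holds with S the preceding partial sum, so by iteration
      |X_1 + ... + X_n|_p^2 <= 4 p (|X_1|_p^2 + ... + |X_n|_p^2)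
    (Lnorm_orthogonal_sum).  Since ln p <= 2 sqrt p and K_Os >= 4, the constant
    satisfies 2 sqrt p <= K_Os p / ln p, which is the case d = 1.

    The rest is an induction on d (Lnorm_form).  Sorting the terms of Q by
    their last index k writes a form of degree d + 1 as the sum over k of
    X_k = xi(k, d+1) Q_k, where Q_k is a form of degree d in the variables of
    time < k, whose array is a slice of b.  As Q_k is measurable for F(k-1), the
    X_k are again martingale differences.  Hoelder's inequality with exponents
    (d+1) p and (1 + 1/d) p bounds |X_k|_p by |xi(k, d+1)|_((d+1)p) times
    |Q_k|_((1+1/d)p), and the induction hypothesis applies to the latter at the
    exponent p' = (1 + 1/d) p, because d p' = (d+1) p.  Its rate (p' / ln p')^d
    is at most (1 + 1/d)^d (p / ln p)^d, and the squared norms of the slices add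
    up to the squared norm of b: this is the recursion defining gamma.

    Four points are needed to pass from this to the statement.  The variables
    xi(i, m) are only almost surely equal to F(i)-measurable functions, so one
    works with adapted versions (adapted_versions).  The orthogonality of an
    increment of zero conditional mean to a function measurable for the past is
    obtained from indicators through simple functions and dominated convergence
    (orthogonal_sub_measurable).  An infinite horizon is handled by
    Fatou's lemma (Lnorm_fatou).  Finally V may be finite because one of
    the suprema vanishes while another is infinite; then Q vanishes almost
    surely. *)

Set Implicit Arguments.
Unset Strict Implicit.
Unset Printing Implicit Defensive.

Import Order.TTheory GRing.Theory Num.Theory.
Import numFieldNormedType.Exports.
Local Open Scope classical_set_scope.
Local Open Scope ring_scope.

(** * A second order expansion of powers *)

Section real_inequalities.
Context {R : realType}.
Implicit Types p q a s u v w x : R.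

(** Convexity: the graph of x^q lies above its tangent at u.  This is Young's
    inequality for v and u^(q-1), and every estimate on powers below follows from
    it. *)
Lemma powR_tangent q u v : 1 <= q -> 0 <= u -> 0 <= v ->
  u `^ q + q * u `^ (q - 1) * (v - u) <= v `^ q.
Proof.
move=> q1 u0 v0.
have q0 : 0 < q by apply: lt_le_trans q1.
have [->|qn1] := eqVneq q 1.
  by rewrite subrr powRr0 !mul1r !powRr1// subrKC.
have q1' : 0 < q - 1 by rewrite subr_gt0 lt_neqAle eq_sym qn1.
have := @conjugate_powR R v (u `^ (q - 1)) q (q / (q - 1)) v0 (powR_ge0 _ _) q0.
rewrite divr_gt0// => /(_ isT).
have -> : q^-1 + (q / (q - 1))^-1 = 1 by field; rewrite !gt_eqF.
move=> /(_ erefl).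
rewrite -powRrM (_ : (q - 1) * (q / (q - 1)) = q); last by field; rewrite gt_eqF.
move=> h.
have uq : u * u `^ (q - 1) = u `^ q by apply: mulr_powRB1.
have {h} : q * (v * u `^ (q - 1)) <=
    q * (v `^ q / q + u `^ q / (q / (q - 1))) by rewrite ler_pM2l.
have -> : q * (v `^ q / q + u `^ q / (q / (q - 1))) = v `^ q + (q - 1) * u `^ q.
  by field; rewrite !gt_eqF.
by rewrite -uq; lra.
Qed.

(** Up to the factor p, this is the derivative of |u|^p. *)
Definition duality_map p u := u * `|u| `^ (p - 2).

Lemma powR_mul2 p u : 2 < p -> 0 <= u -> u `^ p = u * (u * u `^ (p - 2)).
Proof.
move=> p2 u0; rewrite -[X in u * (u * u `^ X)](_ : p - 1 - 1 = _); last by lra.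
by rewrite !mulr_powRB1//; lra.
Qed.

(** The derivative of the duality map is (p-1)|u|^(p-2), which is at most
    (p-1) w^(p-2) on [-w, w]. *)
Lemma duality_map_monotone_lip p u s w : 2 < p -> `|u| <= w -> `|s| <= w ->
  (duality_map p u - duality_map p s) * (u - s) <=
  (p - 1) * (u - s) ^+ 2 * w `^ (p - 2).
Proof.
move=> p2; wlog us : u s / `|s| <= `|u|.
  move=> H uw sw; have [|/ltW] := leP `|s| `|u|; first by move=> ?; exact: H.
  by move=> /H /(_ sw uw); lra.
move=> uw sw.
have := @powR_tangent (p - 1) `|u| `|s|.
rewrite (_ : 1 <= p - 1); last lra.
move=> /(_ isT (normr_ge0 _) (normr_ge0 _)).
rewrite (_ : p - 1 - 1 = p - 2); last lra.
rewrite -!(@mulr_powRB1 _ _ (p - 1))//; try lra.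
rewrite (_ : p - 1 - 1 = p - 2); last lra.
rewrite /duality_map.
have : `|s| `^ (p - 2) <= `|u| `^ (p - 2).
  by apply: ge0_ler_powR; rewrite ?nnegrE//; lra.
have : `|u| `^ (p - 2) <= w `^ (p - 2).
  by apply: ge0_ler_powR; rewrite ?nnegrE ?(le_trans _ uw)//; lra.
have := powR_ge0 `|s| (p - 2).
move: (w `^ _) (`|s| `^ _) (`|u| `^ _) => C B A B0 AC BA h.
suff H : (u * A - s * B) * (u - s) <= (p - 1) * (u - s) ^+ 2 * A.
  apply: (le_trans H); apply: ler_wpM2l => //.
  by rewrite mulr_ge0 ?sqr_ge0//; lra.
(* If u and s have the same sign one compares |u| and |s| through h; if the
   signs differ, A may replace the smaller factor B. *)
have [us0|us0] := leP 0 (u * s).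
  have -> : (u * A - s * B) * (u - s) = (`|u| * A - `|s| * B) * (`|u| - `|s|).
    case: (ger0P u) => hu; case: (ger0P s) => hs; try ring.
    - have -> : u = 0 by apply/eqP; rewrite eq_le hu andbT -(nmulr_lge0 _ hs).
      ring.
    - have -> : s = 0 by apply/eqP; rewrite eq_le hs andbT -(nmulr_rge0 _ hu).
      ring.
  have -> : (u - s) ^+ 2 = (`|u| - `|s|) ^+ 2.
    case: (ger0P u) => hu; case: (ger0P s) => hs; try ring.
    - have -> : u = 0 by apply/eqP; rewrite eq_le hu andbT -(nmulr_lge0 _ hs).
      ring.
    - have -> : s = 0 by apply/eqP; rewrite eq_le hs andbT -(nmulr_rge0 _ hu).
      ring.
  have h1 : `|u| * A - `|s| * B <= (p - 1) * A * (`|u| - `|s|) by lra.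
  have h2 : (`|u| * A - `|s| * B) * (`|u| - `|s|) <=
     ((p - 1) * A * (`|u| - `|s|)) * (`|u| - `|s|).
    by apply: ler_wpM2r => //; lra.
  by apply: (le_trans h2); rewrite expr2; lra.
have h1 : (u * A - s * B) * (u - s) <= (u - s) ^+ 2 * A.
  have -> : (u - s) ^+ 2 * A = (u * A - s * B) * (u - s)
     + (A - B) * (s * s - u * s) by ring.
  rewrite lerDl mulr_ge0//; first lra.
  by have := sqr_ge0 s; rewrite expr2; lra.
apply: (le_trans h1).
have : 0 <= (u - s) ^+ 2 * A by rewrite mulr_ge0 ?sqr_ge0//; lra.
rewrite -mulrA; nra.
Qed.

(** Convexity of |.|^p at s + x bounds |s + x|^p - |s|^p by p x times the duality
    map at s + x; moving the base point from s + x to s costs the quadratic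
    term. *)
Lemma powR_norm_taylor2 p s x : 2 < p ->
  `|s + x| `^ p <= `|s| `^ p + p * duality_map p s * x
                   + p * (p - 1) * (x ^+ 2 * (`|s| + `|x|) `^ (p - 2)).
Proof.
move=> p2.
have := @duality_map_monotone_lip p (s + x) s (`|s| + `|x|) p2 (ler_normD _ _).
rewrite lerDl normr_ge0 => /(_ isT).
rewrite (_ : s + x - s = x); last ring.
have := @powR_tangent p `|s + x| `|s|.
rewrite (_ : 1 <= p); last lra.
move=> /(_ isT (normr_ge0 _) (normr_ge0 _)).
move: (_ `^ (p - 2)) => C.
rewrite -(@mulr_powRB1 _ `|s + x| p)//; last lra.
rewrite -!(@mulr_powRB1 _ `|s + x| (p - 1))//; last lra.
rewrite (_ : p - 1 - 1 = p - 2); last lra.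
have A0 := powR_ge0 `|s + x| (p - 2).
set D := duality_map p s.
rewrite /duality_map; set A := _ `^ (p - 2) in A0 *; set S := _ `^ p.
move=> h1 h2.
have h3 : p * ((s + x) * A * x) >=
     p * (`|s + x| * (`|s + x| * A)) - p * (`|s + x| * A) * `|s|.
  rewrite -!mulrA -mulrBr; apply: ler_wpM2l; first lra.
  have -> : (s + x) * (A * x) = (s + x) ^+ 2 * A - (s + x) * s * A by ring.
  have -> : `|s + x| * (`|s + x| * A) - `|s + x| * (A * `|s|)
    = `|s + x| ^+ 2 * A - `|s + x| * `|s| * A by ring.
  rewrite -normrX ger0_norm ?sqr_ge0// lerB// ler_wpM2r// -normrM ler_norm//.
have h4 : p * (((s + x) * A - D) * x) <= p * ((p - 1) * x ^+ 2 * C).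
  by rewrite ler_pM2l//; lra.
lra.
Qed.

(** For x / a <= 2 / (4p - 1) the factor (1 + x/a)^(p-2) is at most e^(1/2). *)
Lemma powR_one_plus_le2 p a x : 4 <= p -> 0 < a -> 0 <= x ->
  (4 * p - 1) * x <= 2 * a -> (a + x) `^ (p - 2) <= 2 * a `^ (p - 2).
Proof.
move=> p4 a0 x0 xa.
have -> : a + x = (1 + x / a) * a by field; rewrite gt_eqF.
have t0 : 0 <= x / a by rewrite divr_ge0// ltW.
rewrite powRM ?(ltW a0)//; last lra.
apply: ler_wpM2r; first exact: powR_ge0.
rewrite /powR gt_eqF; last lra.
have expR_half : expR (2^-1) <= 2 :> R.
  have : 2^-1 <= expR (- 2^-1) :> R.
    by apply: le_trans (expR_ge1Dx _); lra.
  rewrite expRN => h.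
  by rewrite -lef_pV2 ?posrE ?expR_gt0.
apply: le_trans expR_half; rewrite ler_expR.
have lnle : ln (1 + x / a) <= x / a by apply: le_ln1Dx; lra.
apply: (@le_trans _ _ ((p - 2) * (x / a))).
  by apply: ler_wpM2l => //; lra.
rewrite mulrA ler_pdivrMr//; nra.
Qed.

(** Here m, a and x stand for |S + X|_p, a bound of |S|_p and a bound of |X|_p.
    When x is large with respect to a / p, the triangle inequality m <= a + x
    suffices.  Otherwise (a + x)^(p-2) <= 2 a^(p-2), and the conclusion is
    Bernoulli's inequality for (a^2 + 4 p x^2)^(p/2). *)
Lemma moment_recurrence p a x m : 4 <= p -> 0 <= a -> 0 <= x -> 0 <= m ->
  m <= a + x ->
  m `^ p <= a `^ p + p * (p - 1) * (x ^+ 2 * (a + x) `^ (p - 2)) ->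
  m <= Num.sqrt (a ^+ 2 + 4 * p * x ^+ 2).
Proof.
move=> p4 a0 x0 m0 max mp.
have y0 : 0 <= a ^+ 2 + 4 * p * x ^+ 2.
  by rewrite addr_ge0 ?mulr_ge0 ?sqr_ge0//; lra.
have [xa|xa] := leP (2 * a) ((4 * p - 1) * x).
  apply: (le_trans max); rewrite -(@ger0_norm _ (a + x)) ?addr_ge0//.
  by rewrite -sqrtr_sqr ler_wsqrtr// sqrrD; nra.
have {}a0 : 0 < a by nra.
rewrite leNgt; apply/negP => sm.
have : (Num.sqrt (a ^+ 2 + 4 * p * x ^+ 2)) `^ p < m `^ p.
  by apply: gt0_ltr_powR => //; rewrite ?nnegrE ?sqrtr_ge0//; lra.
apply/negP; rewrite -leNgt; apply: (le_trans mp).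
rewrite -powR12_sqrt// -powRrM.
have := @powR_tangent (2^-1 * p) (a ^+ 2) (a ^+ 2 + 4 * p * x ^+ 2).
rewrite (_ : 1 <= 2^-1 * p); last lra.
rewrite sqr_ge0 y0 => /(_ isT isT isT); apply: le_trans.
rewrite -(powR_mulrn 2 (ltW a0)) -!powRrM.
rewrite (_ : 2%:R * (2^-1 * p) = p); last by field.
rewrite (_ : 2%:R * (2^-1 * p - 1) = p - 2); last by field.
rewrite lerD2l.
have := @powR_one_plus_le2 p a x p4 a0 x0 (ltW xa).
have := powR_ge0 a (p - 2); have := sqr_ge0 x.
move: ((a + x) `^ (p - 2)) (a `^ (p - 2)) => A B X0 B0 AB.
apply: (@le_trans _ _ (p * (p - 1) * (x ^+ 2 * (2 * B)))).
  apply: ler_wpM2l; first by apply: mulr_ge0; lra.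
  exact: ler_wpM2l.
have XB : 0 <= x ^+ 2 * B by rewrite mulr_ge0.
nra.
Qed.

End real_inequalities.

(** * Moment inequalities *)

Section moments.
Context {disp : measure_display} {T : measurableType disp} {R : realType}.
Variable P : probability T R.
Implicit Types (f g S X : T -> R) (p a b r s : R).
Local Open Scope ereal_scope.

Lemma integral_moment_ge0 f p : 0 <= \int[P]_w (`|f w| `^ p)%:E.
Proof. by apply: integral_ge0 => w _; rewrite lee_fin powR_ge0. Qed.

Lemma measurable_powR_norm f p : measurable_fun setT f ->
  measurable_fun setT (fun w => `|f w| `^ p)%R.
Proof.
move=> mf; apply: (measurableT_comp (measurable_powR _)) => //.
exact: measurableT_comp.
Qed.

Lemma Lnorm_leP f p a : (0 < p)%R -> (0 <= a)%R ->
  'N[P]_p%:E[EFin \o f] <= a%:E <-> \int[P]_w (`|f w| `^ p)%:E <= (a `^ p)%:E.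
Proof.
move=> p0 a0.
have itv (x : \bar R) : 0 <= x -> x \in `[0, +oo].
  by move=> x0; rewrite in_itv/= x0 leey.
have powNE : 'N[P]_p%:E[EFin \o f] `^ p = \int[P]_w (`|f w| `^ p)%:E.
  by rewrite poweR_Lnorm ?gt_eqF.
split=> h.
  rewrite -powNE -poweR_EFin; apply: gt0_ler_poweR => //.
  - exact: ltW.
  - by rewrite itv ?Lnorm_ge0.
  - by rewrite itv ?lee_fin.
have := @gt0_ler_poweR R p^-1; rewrite invr_ge0 (ltW p0) => /(_ isT) H.
have {H h} := H _ _ (itv _ (integral_moment_ge0 f p)) (itv _ _) h.
rewrite lee_fin powR_ge0 => /(_ isT).
rewrite -powNE -poweRrM poweR_EFin -powRrM mulfV ?gt_eqF// powRr1//.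
by rewrite poweRe1// Lnorm_ge0.
Qed.

Lemma moment_integrable f p a : measurable_fun setT f -> (0 < p)%R ->
  (0 <= a)%R -> 'N[P]_p%:E[EFin \o f] <= a%:E ->
  P.-integrable setT (fun w => (`|f w| `^ p)%:E).
Proof.
move=> mf p0 a0 /(Lnorm_leP _ p0 a0) h; apply/integrableP; split.
  by apply/measurable_EFinP; exact: measurable_powR_norm.
apply: le_lt_trans (ltry (a `^ p)); apply: le_trans h.
by under eq_integral do rewrite gee0_abs ?lee_fin ?powR_ge0//.
Qed.

Lemma Lnorm_powR f p r a : (0 < p)%R -> (0 < r)%R -> (0 <= a)%R ->
  'N[P]_p%:E[EFin \o f] <= a%:E ->
  'N[P]_(p / r)%:E[EFin \o (fun w => `|f w| `^ r)%R] <= (a `^ r)%:E.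
Proof.
move=> p0 r0 a0 /(Lnorm_leP _ p0 a0) h.
apply/Lnorm_leP; rewrite ?divr_gt0 ?powR_ge0//.
rewrite -powRrM (_ : (r * (p / r) = p)%R); last by field; rewrite gt_eqF.
apply: le_trans h; rewrite le_eqVlt; apply/orP; left; apply/eqP.
apply: eq_integral => w _; rewrite ger0_norm ?powR_ge0// -powRrM.
by rewrite (_ : (r * (p / r) = p)%R)//; field; rewrite gt_eqF.
Qed.

(** Hoelder's inequality for |f|^r |g|^s, in the form used with r + s = p and both
    exponents p, and with r = s = p and two different exponents. *)
Lemma hoelder_powR f g (p q r s : R) a b :
  measurable_fun setT f -> measurable_fun setT g ->
  (0 < p)%R -> (0 < q)%R -> (0 < r)%R -> (0 < s)%R -> (r / p + s / q = 1)%R ->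
  (0 <= a)%R -> (0 <= b)%R ->
  'N[P]_p%:E[EFin \o f] <= a%:E -> 'N[P]_q%:E[EFin \o g] <= b%:E ->
  \int[P]_w (`|f w| `^ r * `|g w| `^ s)%:E <= (a `^ r * b `^ s)%:E.
Proof.
move=> mf mg p0 q0 r0 s0 rs a0 b0 fa gb.
have := @hoelder _ _ _ P _ _ (p / r) (q / s) (measurable_powR_norm r mf)
  (measurable_powR_norm s mg).
rewrite !divr_gt0// !invf_div rs => /(_ isT isT erefl).
rewrite Lnorm1 => h.
have : \int[P]_w (`|f w| `^ r * `|g w| `^ s)%:E <=
   'N[P]_(p / r)%:E[EFin \o (fun w => `|f w| `^ r)%R] *
   'N[P]_(q / s)%:E[EFin \o (fun w => `|g w| `^ s)%R].
  apply: le_trans h; rewrite le_eqVlt; apply/orP; left; apply/eqP.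
  apply: eq_integral => w _.
  by rewrite /= (ger0_norm (mulr_ge0 (powR_ge0 _ _) (powR_ge0 _ _))).
move/le_trans; apply; rewrite [leRHS]EFinM.
by apply: lee_pmul; rewrite ?Lnorm_ge0//; exact: Lnorm_powR.
Qed.

Lemma measurable_duality_map p S : measurable_fun setT S ->
  measurable_fun setT (fun w => duality_map p (S w)).
Proof.
by move=> mS; apply: measurable_funM => //; exact: measurable_powR_norm.
Qed.

Lemma Lnorm_normr f (e : \bar R) :
  'N[P]_e[EFin \o (fun w => `|f w|)%R] = 'N[P]_e[EFin \o f].
Proof. by rewrite -[RHS]Lnorm_abse. Qed.

Lemma Lnorm_normD S X p a b : (1 <= p)%R ->
  measurable_fun setT S -> measurable_fun setT X ->
  'N[P]_p%:E[EFin \o S] <= a%:E -> 'N[P]_p%:E[EFin \o X] <= b%:E ->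
  'N[P]_p%:E[EFin \o (fun w => `|S w| + `|X w|)%R] <= (a + b)%:E.
Proof.
move=> p1 mS mX Sa Xb; apply: le_trans (minkowski_EFin _ _ _ p1) _.
- exact: measurableT_comp.
- exact: measurableT_comp.
- by rewrite EFinD; apply: leeD; rewrite Lnorm_normr.
Qed.

(** The integrand is dominated by (|S| + |X|)^p. *)
Lemma duality_map_integrable S X p a b : (2 < p)%R -> (0 <= a)%R -> (0 <= b)%R ->
  measurable_fun setT S -> measurable_fun setT X ->
  'N[P]_p%:E[EFin \o S] <= a%:E -> 'N[P]_p%:E[EFin \o X] <= b%:E ->
  P.-integrable setT (fun w => (duality_map p (S w) * X w)%:E).
Proof.
move=> p2 a0 b0 mS mX Sa Xb; have p0 : (0 < p)%R by lra.
have NW : 'N[P]_p%:E[EFin \o (fun w => `|S w| + `|X w|)%R] <= (a + b)%:E.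
  by apply: Lnorm_normD => //; lra.
have := moment_integrable _ p0 (addr_ge0 a0 b0) NW.
have mW : measurable_fun setT (fun w => `|S w| + `|X w|)%R.
  by apply: measurable_funD; exact: measurableT_comp.
move=> /(_ mW); apply: le_integrable => //.
  by apply/measurable_EFinP; apply: measurable_funM => //; exact: measurable_duality_map.
move=> w _; rewrite !abse_EFin lee_fin (ger0_norm (powR_ge0 _ _)).
rewrite (ger0_norm (addr_ge0 _ _))// powR_mul2 ?addr_ge0// !normrM.
rewrite (ger0_norm (powR_ge0 _ _)) -mulrA; apply: ler_pM.
- by [].
- by rewrite mulr_ge0 ?powR_ge0.
- by rewrite lerDl.
rewrite mulrC; apply: ler_pM; rewrite ?powR_ge0// ?lerDr//.
by apply: ge0_ler_powR; rewrite ?nnegrE ?lerDl ?(addr_ge0 (normr_ge0 _))//; lra.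
Qed.

(** Integrating the second order expansion of |S + X|^p, the linear term vanishes
    by orthogonality, and Hoelder's inequality bounds the quadratic one by
    p (p-1) b^2 (a + b)^(p-2); moment_recurrence then concludes. *)
Lemma Lnorm_orthogonal_increment S X p a b : (4 <= p)%R -> (0 <= a)%R -> (0 <= b)%R ->
  measurable_fun setT S -> measurable_fun setT X ->
  'N[P]_p%:E[EFin \o S] <= a%:E -> 'N[P]_p%:E[EFin \o X] <= b%:E ->
  \int[P]_w (duality_map p (S w) * X w)%:E = 0 ->
  'N[P]_p%:E[EFin \o (fun w => S w + X w)%R]
     <= (Num.sqrt (a ^+ 2 + 4 * p * b ^+ 2))%:E.
Proof.
move=> p4 a0 b0 mS mX Sa Xb orth.
have p0 : (0 < p)%R by lra.
have p2 : (2 < p)%R by lra.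
have p1 : (1 <= p)%R by lra.
have mW : measurable_fun setT (fun w => `|S w| + `|X w|)%R.
  by apply: measurable_funD; exact: measurableT_comp.
have NW := Lnorm_normD p1 mS mX Sa Xb.
have NSX : 'N[P]_p%:E[EFin \o (fun w => S w + X w)%R] <= (a + b)%:E.
  apply: le_trans (minkowski_EFin _ mS mX p1) _.
  by rewrite EFinD; exact: leeD.
have fNSX : 'N[P]_p%:E[EFin \o (fun w => S w + X w)%R] \is a fin_num.
  by rewrite ge0_fin_numE ?Lnorm_ge0// (le_lt_trans NSX)// ltry.
set N := 'N[P]_p%:E[_] in NSX fNSX *.
have N0 : (0 <= fine N)%R by rewrite fine_ge0// Lnorm_ge0.
rewrite -(fineK fNSX) lee_fin; apply: moment_recurrence => //.
  by rewrite -lee_fin fineK.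
rewrite -lee_fin -fine_poweR fineK; last first.
  by rewrite fin_num_poweR.
rewrite /N poweR_Lnorm ?gt_eqF// => {N NSX fNSX N0}.
have iS : P.-integrable setT (fun w => (`|S w| `^ p)%:E) by apply: (moment_integrable _ p0 a0).
have iSX := duality_map_integrable p2 a0 b0 mS mX Sa Xb.
have mX2W : measurable_fun setT (fun w => X w ^+ 2 * (`|S w| + `|X w|) `^ (p - 2))%R.
  apply: measurable_funM; first exact: measurable_funX.
  exact: (measurableT_comp (measurable_powR _)).
have X2W0 w : (0 <= X w ^+ 2 * (`|S w| + `|X w|) `^ (p - 2))%R.
  by rewrite mulr_ge0 ?sqr_ge0 ?powR_ge0.
have bound : \int[P]_w (X w ^+ 2 * (`|S w| + `|X w|) `^ (p - 2))%:E
    <= (b ^+ 2 * (a + b) `^ (p - 2))%:E.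
  have p20 : (0 < p - 2)%R by lra.
  have exps : (2 / p + (p - 2) / p = 1)%R by field; rewrite gt_eqF.
  have := hoelder_powR mX mW p0 p0 (ltr0Sn _ 1) p20 exps b0 (addr_ge0 a0 b0) Xb NW.
  rewrite (powR_mulrn 2)//; apply: le_trans.
  rewrite le_eqVlt; apply/orP; left; apply/eqP; apply: eq_integral => w _.
  rewrite powR_mulrn ?normr_ge0// real_normK ?num_real//.
  by rewrite (ger0_norm (addr_ge0 _ _)).
have iX2W : P.-integrable setT (fun w => (X w ^+ 2 * (`|S w| + `|X w|) `^ (p - 2))%:E).
  apply/integrableP; split; first exact/measurable_EFinP.
  apply: le_lt_trans (ltry (b ^+ 2 * (a + b) `^ (p - 2))).
  apply: le_trans bound; rewrite le_eqVlt; apply/orP; left; apply/eqP.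
  by apply: eq_integral => w _; rewrite gee0_abs// lee_fin.
have i1 := integrableZl measurableT p iSX.
have i2 := integrableZl measurableT (p * (p - 1)) iX2W.
apply: (@le_trans _ _ (\int[P]_w ((`|S w| `^ p)%:E +
   (p%:E * (duality_map p (S w) * X w)%:E +
   (p * (p - 1))%:E * (X w ^+ 2 * (`|S w| + `|X w|) `^ (p - 2))%:E)))).
  apply: ge0_le_integral => //.
  - by move=> w _; rewrite lee_fin powR_ge0.
  - apply/measurable_EFinP; apply: measurable_powR_norm.
    exact: measurable_funD.
  - apply: measurable_int (integrableD measurableT iS (integrableD measurableT i1 i2)).
  - move=> w _; rewrite -!EFinM -!EFinD lee_fin addrA mulrA.
    exact: powR_norm_taylor2.
rewrite integralD//; last exact: integrableD.
rewrite integralD// !integralZl// orth mule0 add0e EFinD.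
apply: leeD; first exact/Lnorm_leP.
by rewrite [leRHS]EFinM lee_pmul2l// lte_fin mulr_gt0//; lra.
Qed.

End moments.

(** * Orthogonality to the functions of the past *)

Section sub_sigma_algebra.
Context {disp : measure_display} {T : measurableType disp} {R : realType}.
Variable P : probability T R.
Implicit Types (G H : set_system T) (Y Z f : T -> R).

Definition sub_measurable G f :=
  measurable_fun setT (f : g_sigma_algebraType G -> R).

Lemma sub_measurableP G f : sigma_algebra setT G ->
  (forall A : set R, measurable A -> G (f @^-1` A)) <-> sub_measurable G f.
Proof.
move=> sG; have mG : @measurable _ (g_sigma_algebraType G) = G.
  exact: measurable_g_measurableTypeE.
split=> [Gf _ A mA|mf A mA]; first by rewrite setTI mG; exact: Gf.
by have := mf measurableT _ mA; rewrite setTI mG.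
Qed.

Lemma sub_measurableS G H f : sigma_algebra setT G -> sigma_algebra setT H ->
  G `<=` H -> sub_measurable G f -> sub_measurable H f.
Proof.
move=> sG sH GH /(sub_measurableP _ sG) Gf; apply/sub_measurableP => // A mA.
exact/GH/Gf.
Qed.

Lemma sub_measurableW G f : sigma_algebra setT G ->
  G `<=` measurable -> sub_measurable G f -> measurable_fun setT f.
Proof.
move=> sG Gm /(sub_measurableP _ sG) Gf _ A mA; rewrite setTI.
exact/Gm/Gf.
Qed.

Local Open Scope ereal_scope.
Import HBNNSimple.

(** By hypothesis Y is orthogonal to the indicators of the sets of G, hence to
    the simple functions increasing to Z; as these are below Z, the function
    |Y Z| dominates and the integrals converge. *)
Lemma orthogonal_ge0 G Y Z : sigma_algebra setT G -> G `<=` measurable ->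
  P.-integrable setT (EFin \o Y) ->
  (forall A, G A -> \int[P]_(w in A) (Y w)%:E = 0) ->
  sub_measurable G Z -> (forall w, 0 <= Z w)%R ->
  P.-integrable setT (fun w => (Y w * Z w)%:E) ->
  \int[P]_w (Y w * Z w)%:E = 0.
Proof.
move=> sG Gm iY Y0 mZ Z0 iYZ.
have mEZ : measurable_fun setT (EFin \o Z : g_sigma_algebraType G -> \bar R).
  exact/measurable_EFinP.
pose g := nnsfun_approx measurableT mEZ.
have EZ0 (w : g_sigma_algebraType G) : setT w -> 0 <= (EFin \o Z) w.
  by move=> _; rewrite lee_fin.
have gZ w : EFin \o (fun n => g n w) @ \oo --> (Z w)%:E.
  exact: (cvg_nnsfun_approx measurableT mEZ EZ0).
have g_le n w : (g n w <= Z w)%R.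
  by rewrite -lee_fin /g nnsfun_approxE; apply: le_approx.
have mGg n : sub_measurable G (g n : T -> R) by rewrite /sub_measurable.
have mg n : measurable_fun setT (g n : T -> R).
  exact: (sub_measurableW sG Gm).
have Ggr n r : G (g n @^-1` [set r]).
  by move/(sub_measurableP _ sG): (mGg n); apply; exact: measurable_set1.
have ig n r : P.-integrable setT
    (fun w => (Y w * (r * \1_(g n @^-1` [set r]) w))%:E).
  apply: le_integrable (integrableZl measurableT r iY) => //.
    apply/measurable_EFinP; apply: measurable_funM => //.
      exact/measurable_EFinP/(measurable_int _ iY).
    apply: measurable_funM => //; apply: measurable_indic.
    exact/Gm/Ggr.
  move=> w _; rewrite -EFinM !abse_EFin lee_fin [leLHS]normrM mulrC normrM.
  rewrite normrM -mulrA ler_wpM2l// ler_piMl// indicE.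
  by case: (_ \in _); rewrite ?normr1 ?normr0.
have Yg0 n : \int[P]_w (Y w * g n w)%:E = 0.
  under eq_integral => w _.
    rewrite (fimfunE (g n) w) (fsbig_finite) //= mulr_sumr -sumEFin.
    over.
  rewrite integral_sum//= big1// => r _.
  transitivity (r%:E * \int[P]_(w in g n @^-1` [set r]) (Y w)%:E); last first.
    by rewrite Y0 ?mule0.
  rewrite -integralZl//; last 2 first.
    exact/Gm/Ggr.
    by apply: integrableS iY => //; exact/Gm/Ggr.
  rewrite [RHS]integral_mkcond.
  apply: eq_integral => w _; rewrite patchE indicE.
  by case: ifP => _; rewrite ?mulr1 ?mulr0 ?mule0// -EFinM mulrC.
have cv : (fun n => \int[P]_w (Y w * g n w)%:E) @ \oo --> \int[P]_w (Y w * Z w)%:E.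
  have [] := @dominated_convergence _ _ _ P setT measurableT
    (fun n w => (Y w * g n w)%:E) (fun w => (Y w * Z w)%:E)
    (fun w => `|(Y w * Z w)%:E|).
  - move=> n; apply/measurable_EFinP; apply: measurable_funM => //.
    exact/measurable_EFinP/(measurable_int _ iY).
  - exact: measurable_int iYZ.
  - apply: nearW => w _; under eq_fun do rewrite EFinM.
    rewrite EFinM; apply: cvgeZl => //; exact: gZ.
  - exact: integrable_abse.
  - apply: nearW => w n _; rewrite !abse_EFin lee_fin !normrM.
    by rewrite ler_wpM2l// !ger0_norm.
  by [].
apply: (cvg_unique _ cv) => //.
rewrite (_ : (fun n => _) = cst 0); first exact: cvg_cst.
by apply/funext => n; exact: Yg0.
Qed.

(** In conditional terms, E[Y | G] = 0 implies E[Y Z] = 0: take the positive and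
    the negative part of Z. *)
Lemma orthogonal_sub_measurable G Y Z : sigma_algebra setT G ->
  G `<=` measurable -> P.-integrable setT (EFin \o Y) ->
  (forall A, G A -> \int[P]_(w in A) (Y w)%:E = 0) ->
  sub_measurable G Z ->
  P.-integrable setT (fun w => (Y w * Z w)%:E) ->
  \int[P]_w (Y w * Z w)%:E = 0.
Proof.
move=> sG Gm iY Y0 mZ iYZ.
have mY : measurable_fun setT Y by exact/measurable_EFinP/(measurable_int _ iY).
have part (Z' : T -> R) : sub_measurable G Z' ->
    (forall w, 0 <= Z' w <= `|Z w|)%R ->
    P.-integrable setT (fun w => (Y w * Z' w)%:E) /\
    \int[P]_w (Y w * Z' w)%:E = 0.
  move=> mZ' Z'Z.
  have iYZ' : P.-integrable setT (fun w => (Y w * Z' w)%:E).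
    apply: le_integrable iYZ => //.
      apply/measurable_EFinP; apply: measurable_funM => //.
      exact: sub_measurableW mZ'.
    move=> w _; rewrite !abse_EFin lee_fin !normrM ler_wpM2l//.
    by have /andP[Z'0 le] := Z'Z w; rewrite (ger0_norm Z'0).
  split=> //; apply: (orthogonal_ge0 sG Gm iY Y0 mZ') => // w.
  by have /andP[] := Z'Z w.
have [i1 e1] : P.-integrable setT (fun w => (Y w * (Num.max (Z w) 0))%:E) /\
    \int[P]_w (Y w * (Num.max (Z w) 0))%:E = 0.
  apply: part => [|w]; first exact: measurable_funrpos.
  by rewrite le_max lexx orbT ge_max ler_norm normr_ge0.
have [i2 e2] : P.-integrable setT (fun w => (Y w * (Num.max (- Z w) 0))%:E) /\
    \int[P]_w (Y w * (Num.max (- Z w) 0))%:E = 0.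
  apply: part => [|w]; first exact: measurable_funrneg.
  by rewrite le_max lexx orbT ge_max -normrN ler_norm normr_ge0.
transitivity (\int[P]_w ((Y w * (Num.max (Z w) 0))%:E -
                         (Y w * (Num.max (- Z w) 0))%:E)).
  apply: eq_integral => w _; rewrite -EFinB -mulrBr; congr (_ * _)%:E.
  rewrite !maxEle oppr_le0; by case: ltgtP => [Z0|Z0|->]; rewrite ?subr0 ?sub0r ?opprK ?oppr0.
by rewrite (integralB_EFin measurableT i1 i2) e1 e2 sube0.
Qed.

End sub_sigma_algebra.

(** * Increasing multi-indices *)

Section multi_indices.

Definition extend_index {d : nat} (k : nat) (i : {ffun 'I_d -> nat}) :
    {ffun 'I_d.+1 -> nat} :=
  [ffun s => if unlift ord_max s is Some t then i t else k].

Lemma extend_index_max d k (i : {ffun 'I_d -> nat}) :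
  extend_index k i ord_max = k.
Proof. by rewrite ffunE unlift_none. Qed.

Lemma extend_index_lift d k (i : {ffun 'I_d -> nat}) (t : 'I_d) :
  extend_index k i (lift ord_max t) = i t.
Proof. by rewrite ffunE liftK. Qed.

Lemma extend_index_inj d k : injective (@extend_index d k).
Proof.
by move=> i j ij; apply/ffunP => t; rewrite -(extend_index_lift k) ij
  extend_index_lift.
Qed.

Lemma multi_index0 n : multi_index 0 n = [set [ffun=> 0%N]].
Proof.
apply/seteqP; split => [i _|i _]; first by apply/ffunP => -[].
by split=> -[].
Qed.

Lemma multi_index_empty d : multi_index d.+1 (Some 0%N) = set0.
Proof.
apply/seteqP; split => // i [/(_ ord0)/andP[i1 i0] _].
by move: (leq_trans i1 i0).
Qed.

Lemma multi_index_le_max d n (i : {ffun 'I_d.+1 -> nat}) s :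
  multi_index d.+1 n i -> (i s <= i ord_max)%N.
Proof.
move=> [_ inc]; have := leq_ord s; rewrite leq_eqVlt => /predU1P[sd|sd].
  by rewrite (_ : s = ord_max)//; exact: val_inj.
by apply/ltnW/inc.
Qed.

(** An increasing multi-index with values up to N+1 either stays below N+1 or
    ends with N+1. *)
Lemma multi_index_rec d N : multi_index d.+1 (Some N.+1) =
  multi_index d.+1 (Some N) `|` (extend_index N.+1 @` multi_index d (Some N)).
Proof.
apply/seteqP; split => [i mi|i [[ti inc]|[j [tj inc] <-]]].
- have [ti inc] := mi.
  have [iN|Ni] := leqP (i ord_max) N.
    left; split=> // s; rewrite /time_in; have /andP[-> _] /= := ti s.
    exact: leq_trans (multi_index_le_max s mi) iN.
  right; exists [ffun t => i (lift ord_max t)].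
    split=> [t|s t st]; rewrite !ffunE; last first.
      by apply: inc; rewrite !lift_max.
    rewrite /time_in; have /andP[-> _] /= := ti (lift ord_max t).
    have /andP[_ iN1] := ti ord_max; rewrite -ltnS.
    by apply: leq_trans iN1; apply: inc; rewrite lift_max.
  apply/ffunP => s; case: (unliftP ord_max s) => [t ->|->].
    by rewrite extend_index_lift ffunE.
  rewrite extend_index_max; apply/eqP; rewrite eqn_leq Ni.
  by have /andP[_ ->] := ti ord_max.
- split=> // s; rewrite /time_in; have /andP[-> /= iN] := ti s; exact: leqW.
- split=> [s|s t].
    case: (unliftP ord_max s) => [s' ->|->].
      by rewrite extend_index_lift /time_in; have /andP[-> /= iN] := tj s'; exact: leqW.
    by rewrite extend_index_max /time_in/= leqnn.
  case: (unliftP ord_max t) => [t' ->|->]; case: (unliftP ord_max s) => [s' ->|->].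
  + by rewrite !extend_index_lift !lift_max; exact: inc.
  + by rewrite lift_max => dt; have := ltn_trans dt (ltn_ord t'); rewrite ltnn.
  + by rewrite extend_index_lift extend_index_max ltnS; have /andP[] := tj s'.
  + by rewrite ltnn.
Qed.

Lemma finite_multi_index d N : finite_set (multi_index d (Some N)).
Proof.
elim: d N => [|d IHd] N; first by rewrite multi_index0; exact: finite_set1.
elim: N => [|N IHN]; first by rewrite multi_index_empty; exact: finite_set0.
by rewrite multi_index_rec finite_setU; split=> //; exact: finite_image.
Qed.

Lemma fsum_multi_index_rec (V : nmodType) d N (G : {ffun 'I_d.+1 -> nat} -> V) :
  \sum_(i \in multi_index d.+1 (Some N)) G i =
  \sum_(k < N) \sum_(i \in multi_index d (Some (k : nat))) G (extend_index k.+1 i).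
Proof.
elim: N => [|N IHN]; first by rewrite multi_index_empty fsbig_set0 big_ord0.
rewrite big_ord_recr/= -IHN multi_index_rec fsbigU0.
- congr (_ + _); apply: fsbig_image => i j _ _; exact: extend_index_inj.
- exact: finite_multi_index.
- by apply: finite_image; exact: finite_multi_index.
- move=> i [[ti _] [j _ ij]]; have /andP[_] := ti ord_max.
  by rewrite -ij extend_index_max ltnn.
Qed.

End multi_indices.

(** * Constants *)

Section constants.
Context {R : realType}.
Implicit Types p : R.

Lemma ln_gt0_ge4 p : 4 <= p -> 0 < ln p.
Proof. by move=> p4; apply: ln_gt0; lra. Qed.

(** The supremum dominates its value at p = 4, which is
    sqrt 2 * 2^(1/4) * (8 + 2 ln 2) >= 8. *)
Lemma K_Os_ge4 : 4 <= K_Os :> R.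
Proof.
have ln2 : 0 < ln 2 :> R by apply: ln_gt0; lra.
have ln4 : ln 4 = 2 * ln 2 :> R.
  by rewrite (_ : 4 = 2 ^+ 2 :> R) ?lnXn ?mulr_natl//; lra.
apply: (@le_trans _ _ (Os 4 / (4 / ln 4))); last first.
  by apply: (ub_le_sup (has_sup_K_Os (R := R)).2); exists 4 => /=.
have -> : Os 4 / (4 / ln 4) = Num.sqrt 2 * (2 `^ (4^-1)) * (8 + 2 * ln 2) :> R.
  rewrite /Os (_ : 4 / 4 + 1 = 2); last by field.
  rewrite (_ : 4 / 2 = 2); last by field.
  by rewrite ln4; field; rewrite gt_eqF.
have s1 : 1 <= Num.sqrt 2 :> R by rewrite -[leLHS]sqrtr1 ler_sqrt//; lra.
have s2 : 1 <= 2 `^ (4^-1) :> R.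
  by rewrite -[leLHS](powRr0 2) ler_powR//; lra.
have s3 : 1 <= Num.sqrt 2 * 2 `^ (4^-1) :> R by rewrite mulr_ege1.
have : 0 <= (Num.sqrt 2 * 2 `^ (4^-1) - 1) * (8 + 2 * ln 2) :> R.
  by rewrite mulr_ge0//; lra.
rewrite mulrBl; lra.
Qed.

(** From ln (sqrt p) <= sqrt p one gets 2 sqrt p ln p <= 4 p. *)
Lemma sqrt_le_K_Os_rate p : 4 <= p -> Num.sqrt (4 * p) <= K_Os * (p / ln p).
Proof.
move=> p4; have lnp := ln_gt0_ge4 p4; have p0 : 0 < p by lra.
have s0 : 0 < Num.sqrt p by rewrite sqrtr_gt0.
have ss : Num.sqrt p * Num.sqrt p = p by rewrite -expr2 sqr_sqrtr// ltW.
have lns : ln p <= 2 * Num.sqrt p.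
  rewrite -{1}ss lnM ?posrE//.
  by have := ln_sublinear s0; lra.
have -> : Num.sqrt (4 * p) = 2 * Num.sqrt p.
  by rewrite sqrtrM// (_ : 4 = 2 ^+ 2 :> R) ?sqrtr_sqr ?ger0_norm//; ring.
rewrite mulrA ler_pdivlMr//.
apply: (@le_trans _ _ (4 * p)); last by rewrite ler_pM2r// K_Os_ge4.
rewrite -[X in 4 * X]ss; nra.
Qed.

Lemma gammaS d : (1 <= d)%N ->
  gamma d.+1 = gamma d * K_Os * (1 + d%:R^-1) ^+ d :> R.
Proof. by case: d. Qed.

Lemma gamma_ge0 d : 0 <= gamma d :> R.
Proof.
have K0 : 0 <= K_Os :> R by apply: le_trans K_Os_ge4; lra.
elim: d => [//|[|d] IHd]; first by rewrite /=.
by rewrite gammaS// !mulr_ge0// exprn_ge0// addr_ge0.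
Qed.

Lemma rate_ge0 p d : 4 <= p -> 0 <= p ^+ d / ln p ^+ d.
Proof. by move=> p4; rewrite divr_ge0// exprn_ge0// ?ltW ?ln_gt0_ge4//; lra. Qed.

(** Raising p to c p multiplies the power by c^d and can only increase the
    logarithm. *)
Lemma rate_scale p c d : 4 <= p -> 1 <= c ->
  (p * c) ^+ d / ln (p * c) ^+ d <= c ^+ d * (p ^+ d / ln p ^+ d).
Proof.
move=> p4 c1; have lnp := ln_gt0_ge4 p4.
rewrite exprMn (mulrC (p ^+ d) (c ^+ d)) -mulrA; apply: ler_wpM2l.
  by rewrite exprn_ge0//; lra.
apply: ler_wpM2l; first by rewrite exprn_ge0//; lra.
have c4 : 4 <= p * c by nra.
have lnpc := ln_gt0_ge4 c4.
have lnle : ln p <= ln (p * c) by rewrite ler_ln ?posrE; nra.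
rewrite lef_pV2 ?posrE ?exprn_gt0//.
by apply: lerXn2r => //; rewrite nnegrE ltW.
Qed.

End constants.

(** * Sums of orthogonal increments *)

Section orthogonal_sums.
Context {disp : measure_display} {T : measurableType disp} {R : realType}.
Variable P : probability T R.
Local Open Scope ereal_scope.

(** The squared bounds a_k of the norms of the partial sums satisfy
    a_(k+1)^2 = a_k^2 + 4 p x_k^2.  Orthogonality is only requested under the
    integrability of the product, because the latter comes from the bound on
    the partial sum which this induction provides. *)
Lemma Lnorm_orthogonal_sum (p : R) (X : nat -> T -> R) (x : nat -> R) N :
  (4 <= p)%R ->
  (forall k, (k < N)%N ->
    [/\ measurable_fun setT (X k), (0 <= x k)%R,
        'N[P]_p%:E[EFin \o X k] <= (x k)%:E &
        P.-integrable setT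
          (fun w => (duality_map p (\sum_(j < k) X j w) * X k w)%:E) ->
        \int[P]_w (duality_map p (\sum_(j < k) X j w) * X k w)%:E = 0]) ->
  'N[P]_p%:E[EFin \o (fun w => \sum_(k < N) X k w)%R]
    <= (Num.sqrt (4 * p * \sum_(k < N) x k ^+ 2))%:E.
Proof.
move=> p4; have p0 : (0 < p)%R by lra.
elim: N => [_|N IHN hX].
  rewrite (_ : EFin \o _ = cst 0); last by apply/funext => w /=; rewrite big_ord0.
  by rewrite Lnorm0 ?lee_fin ?sqrtr_ge0// eqe gt_eqF.
have [mX x0 Xx orth] := hX N (ltnSn N).
have {}IHN := IHN (fun k kN => hX k (ltnW kN)).
have mS : measurable_fun setT (fun w => \sum_(k < N) X k w)%R.
  by apply: measurable_sum => k; have [] := hX k (ltnW (ltn_ord k)).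
have s0 : (0 <= \sum_(k < N) x k ^+ 2)%R by apply: sumr_ge0 => k _; exact: sqr_ge0.
have p2 : (2 < p)%R by lra.
have {}orth := orth (duality_map_integrable p2 (sqrtr_ge0 _) x0 mS mX IHN Xx).
have := Lnorm_orthogonal_increment p4 (sqrtr_ge0 _) x0 mS mX IHN Xx orth.
rewrite sqr_sqrtr; last by rewrite mulr_ge0//; lra.
rewrite -mulrDr big_ord_recr/=; congr (_ <= _).
by congr Lnorm; apply/funext => w /=; rewrite big_ord_recr.
Qed.

(** The exponents are conjugate with respect to p:
    1/((c+1)p) + 1/((1+1/c)p) = 1/p. *)
Lemma Lnorm_mul (f g : T -> R) (p c a b : R) :
  measurable_fun setT f -> measurable_fun setT g ->
  (0 < p)%R -> (0 < c)%R -> (0 <= a)%R -> (0 <= b)%R ->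
  'N[P]_((c + 1) * p)%:E[EFin \o f] <= a%:E ->
  'N[P]_(p * (1 + c^-1))%:E[EFin \o g] <= b%:E ->
  'N[P]_p%:E[EFin \o (fun w => f w * g w)%R] <= (a * b)%:E.
Proof.
move=> mf mg p0 c0 a0 b0 fa gb; apply/Lnorm_leP; rewrite ?mulr_ge0//.
have q0 : (0 < p * (1 + c^-1))%R by rewrite mulr_gt0// addr_gt0// invr_gt0.
have cp0 : (0 < (c + 1) * p)%R by rewrite mulr_gt0//; lra.
have exps : (p / ((c + 1) * p) + p / (p * (1 + c^-1)) = 1)%R.
  by field; rewrite !gt_eqF//; lra.
rewrite powRM//; apply: le_trans (hoelder_powR mf mg cp0 q0 p0 p0 exps a0 b0 fa gb).
rewrite le_eqVlt; apply/orP; left; apply/eqP; apply: eq_integral => w _.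
by rewrite normrM powRM.
Qed.

Lemma Lnorm_mul_cst (f : T -> R) (p c a : R) :
  measurable_fun setT f -> (0 < p)%R -> (0 <= a)%R ->
  'N[P]_p%:E[EFin \o f] <= a%:E ->
  'N[P]_p%:E[EFin \o (fun w => f w * c)%R] <= (a * `|c|)%:E.
Proof.
move=> mf p0 a0 fa; apply/Lnorm_leP; rewrite ?mulr_ge0//.
have /(Lnorm_leP _ _ p0 a0) fa' := fa.
under eq_integral => w _ do rewrite normrM powRM// mulrC EFinM.
rewrite ge0_integralZl//; last first.
  by apply/measurable_EFinP; exact: measurable_powR_norm.
by rewrite powRM// mulrC EFinM lee_wpmul2l// lee_fin powR_ge0.
Qed.

End orthogonal_sums.

(** * Multilinear forms in martingale differences *)

Section multilinear_form.
Context {disp : measure_display} {T : measurableType disp} {R : realType}.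
Variables (P : probability T R) (F : nat -> set_system T).
Hypothesis hF : filtration F.

(** Over bare functions, so as to apply to adapted versions of the random
    variables. *)
Definition form {d} (Y : nat -> 'I_d -> T -> R) (N : nat)
    (b : {ffun 'I_d -> nat} -> R) (w : T) : R :=
  \sum_(i \in multi_index d (Some N)) b i * \prod_(s < d) Y (i s) s w.

Definition sqnorm {d} (N : nat) (b : {ffun 'I_d -> nat} -> R) : R :=
  \sum_(i \in multi_index d (Some N)) b i ^+ 2.

(** The index is shifted so that F i is the past of the variable of time i.+1. *)
Definition difference_family {d} (N : nat) (q : R) (M : 'I_d -> R)
    (Y : nat -> 'I_d -> T -> R) : Prop :=
  forall i m, (i < N)%N ->
  [/\ sub_measurable (F i.+1) (Y i.+1 m),
      P.-integrable setT (EFin \o Y i.+1 m),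
      forall A, F i A -> (\int[P]_(w in A) (Y i.+1 m w)%:E = 0)%E &
      ('N[P]_q%:E[EFin \o Y i.+1 m] <= (M m)%:E)%E].

Definition drop_last {d} {A : Type} (f : 'I_d.+1 -> A) : 'I_d -> A :=
  fun s => f (lift ord_max s).

Definition slice {d} (b : {ffun 'I_d.+1 -> nat} -> R) k :
  {ffun 'I_d -> nat} -> R := b \o extend_index k.

Lemma sqnorm_ge0 d N (b : {ffun 'I_d -> nat} -> R) : 0 <= sqnorm N b.
Proof. by apply: fsumr_ge0 => i _; exact: sqr_ge0. Qed.

Lemma form0 Y N (b : {ffun 'I_0 -> nat} -> R) w :
  form Y N b w = b [ffun=> 0%N].
Proof. by rewrite /form multi_index0 fsbig_set1 big_ord0 mulr1. Qed.

Lemma sqnorm0 N (b : {ffun 'I_0 -> nat} -> R) : sqnorm N b = b [ffun=> 0%N] ^+ 2.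
Proof. by rewrite /sqnorm multi_index0 fsbig_set1. Qed.

(** The terms are grouped by their last index k+1; the remaining indices are then
    at most k. *)
Lemma form_rec d Y N (b : {ffun 'I_d.+1 -> nat} -> R) w :
  form Y N b w = \sum_(k < N)
    Y k.+1 ord_max w * form (fun i => drop_last (Y i)) k (slice b k.+1) w.
Proof.
rewrite /form fsum_multi_index_rec; apply: eq_bigr => k _.
rewrite mulr_fsumr; apply: eq_fsbigr => i _.
rewrite (bigD1_ord ord_max)//= extend_index_max mulrCA; congr (_ * (_ * _)).
by apply: eq_bigr => s _; rewrite extend_index_lift.
Qed.

Lemma sqnorm_rec d N (b : {ffun 'I_d.+1 -> nat} -> R) :
  sqnorm N b = \sum_(k < N) sqnorm k (slice b k.+1).
Proof. exact: fsum_multi_index_rec. Qed.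

Let sF i : sigma_algebra setT (F i). Proof. by case: hF. Qed.
Let Fm i : F i `<=` measurable. Proof. by case: hF. Qed.

Lemma filtration_mono i j : (i <= j)%N -> F i `<=` F j.
Proof.
case: hF => _ _ FS _; elim: j => [|j IHj]; first by rewrite leqn0 => /eqP->.
rewrite leq_eqVlt => /predU1P[->//|/IHj Fij]; exact: subset_trans Fij (FS j).
Qed.

Lemma difference_family_drop d N N' q q' M (Y : nat -> 'I_d.+1 -> T -> R) :
  (N' <= N)%N -> q = q' -> difference_family N q M Y ->
  difference_family N' q' (drop_last M) (fun i => drop_last (Y i)).
Proof.
by move=> N'N <- h i m iN'; apply: h; exact: leq_trans N'N.
Qed.

Lemma form_sub_measurable d N q M (Y : nat -> 'I_d -> T -> R) b :
  difference_family N q M Y -> sub_measurable (F N) (form Y N b).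
Proof.
elim: d N M Y b => [|d IHd] N M Y b hY.
  rewrite (_ : form Y N b = cst (b [ffun=> 0%N])); first exact: measurable_cst.
  by apply/funext => w; exact: form0.
rewrite (_ : form Y N b = fun w => \sum_(k < N)
    Y k.+1 ord_max w * form (fun i => drop_last (Y i)) k (slice b k.+1) w).
  apply: measurable_sum => k; apply: measurable_funM.
    have [mY _ _ _] := hY k ord_max (ltn_ord k).
    by apply: sub_measurableS mY => //; exact: filtration_mono.
  have hY' := difference_family_drop (ltnW (ltn_ord k)) erefl hY.
  apply: sub_measurableS (IHd _ _ _ _ hY') => //.
  exact/filtration_mono/ltnW.
by apply/funext => w; exact: form_rec.
Qed.

(** The terms of form_rec are orthogonal increments: the partial sum up to k and
    the form multiplying the variable of time k+1 are both functions of F(k).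
    Their squared norms are summed by sqnorm_rec. *)
Lemma Lnorm_form_rec d N p (M : 'I_d.+1 -> R) (Y : nat -> 'I_d.+1 -> T -> R)
    (b : {ffun 'I_d.+1 -> nat} -> R) (C q : R) :
  4 <= p -> 0 <= C -> difference_family N q M Y ->
  (forall k, (k < N)%N ->
    'N[P]_p%:E[EFin \o (fun w => Y k.+1 ord_max w *
        form (fun i => drop_last (Y i)) k (slice b k.+1) w)%R]
      <= (C * Num.sqrt (sqnorm k (slice b k.+1)))%:E)%E ->
  ('N[P]_p%:E[EFin \o form Y N b]
     <= (Num.sqrt (4 * p) * C * Num.sqrt (sqnorm N b))%:E)%E.
Proof.
move=> p4 C0 hY hX.
pose X k w := Y k.+1 ord_max w * form (fun i => drop_last (Y i)) k (slice b k.+1) w.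
pose x k := C * Num.sqrt (sqnorm k (slice b k.+1)).
have mY k : (k < N)%N -> measurable_fun setT (Y k.+1 ord_max).
  by move=> kN; have [mY _ _ _] := hY k ord_max kN; exact: sub_measurableW mY.
have mZ k : (k < N)%N ->
    sub_measurable (F k) (form (fun i => drop_last (Y i)) k (slice b k.+1)).
  move=> kN; apply: form_sub_measurable.
  exact: difference_family_drop (ltnW kN) erefl hY.
have mX k : (k < N)%N -> measurable_fun setT (X k).
  move=> kN; apply: measurable_funM; first exact: mY.
  exact: sub_measurableW (mZ _ kN).
have SE k w : \sum_(j < k) X j w = form Y k b w by rewrite form_rec.
have x0 k : 0 <= x k by rewrite mulr_ge0 ?sqrtr_ge0.
have -> : form Y N b = fun w => \sum_(k < N) X k w.
  by apply/funext => w; rewrite SE.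
have -> : Num.sqrt (4 * p) * C * Num.sqrt (sqnorm N b) =
    Num.sqrt (4 * p * \sum_(k < N) x k ^+ 2).
  rewrite [RHS]sqrtrM; last lra.
  rewrite -mulrA; congr (_ * _).
  have -> : \sum_(k < N) x k ^+ 2 = C ^+ 2 * sqnorm N b.
    rewrite sqnorm_rec mulr_sumr; apply: eq_bigr => k _.
    by rewrite exprMn sqr_sqrtr// sqnorm_ge0.
  by rewrite [RHS]sqrtrM ?sqr_ge0// sqrtr_sqr ger0_norm.
apply: Lnorm_orthogonal_sum => // k kN.
split=> //; [exact: mX|exact: hX|].
have [mY0 iY Y0 _] := hY k ord_max kN.
have -> : (fun w => (duality_map p (\sum_(j < k) X j w) * X k w)%:E) =
    (fun w => (Y k.+1 ord_max w * (form (fun i => drop_last (Y i)) k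
       (slice b k.+1) w * duality_map p (form Y k b w)))%:E).
  by apply/funext => w; rewrite SE mulrC /X mulrA.
apply: (orthogonal_sub_measurable (G := F k)) => //.
apply: measurable_funM; first exact: mZ.
apply: measurable_duality_map.
apply: (form_sub_measurable (q := q) (M := M)) => i m ik.
exact: hY (ltn_trans ik kN).
Qed.

(** In dimension one the slices are constants, which multiply the norm of the
    variable.  In dimension d+2 the form of degree d+1 is estimated at the
    exponent p c with c = 1 + 1/(d+1). *)
Lemma Lnorm_form d N p (M : 'I_d -> R) (Y : nat -> 'I_d -> T -> R) b :
  (1 <= d)%N -> 4 <= p -> (forall m, 0 <= M m) ->
  difference_family N (d%:R * p) M Y ->
  ('N[P]_p%:E[EFin \o form Y N b] <=
   (gamma d * (p ^+ d / ln p ^+ d) * \prod_(m < d) M m *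
    Num.sqrt (sqnorm N b))%:E)%E.
Proof.
case: d M Y b => // d M Y b _.
elim: d N p M Y b => [|d IHd] N p M Y b p4 M0 hY;
  have p0 : 0 < p by [lra]; have lnp := ln_gt0_ge4 p4.
  have step k : (k < N)%N ->
      ('N[P]_p%:E[EFin \o (fun w => Y k.+1 ord_max w *
          form (fun i => drop_last (Y i)) k (slice b k.+1) w)%R]
        <= (M ord_max * Num.sqrt (sqnorm k (slice b k.+1)))%:E)%E.
    move=> kN; have [mY _ _ YM] := hY k ord_max kN.
    rewrite sqnorm0 sqrtr_sqr.
    under eq_Lnorm => w do rewrite /= form0.
    apply: Lnorm_mul_cst => //; first exact: sub_measurableW mY.
    by move: YM; rewrite mul1r.
  apply: le_trans (Lnorm_form_rec p4 (M0 _) hY step) _.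
  rewrite lee_fin; apply: ler_wpM2r; first exact: sqrtr_ge0.
  rewrite big_ord1 (_ : ord_max = ord0); last exact: val_inj.
  by rewrite ler_wpM2r// /= !expr1 sqrt_le_K_Os_rate.
pose c : R := 1 + d.+1%:R^-1.
have d0 : 0 < d.+1%:R :> R by rewrite ltr0n.
have c1 : 1 <= c by rewrite lerDl invr_ge0 ltW.
have pc4 : 4 <= p * c by nra.
pose C := gamma d.+1 * ((p * c) ^+ d.+1 / ln (p * c) ^+ d.+1) *
  \prod_(m < d.+1) drop_last M m.
have C0 : 0 <= C.
  by apply: mulr_ge0; [rewrite mulr_ge0 ?gamma_ge0 ?rate_ge0|
    rewrite prodr_ge0// => m _; exact: M0].
have step k : (k < N)%N ->
    ('N[P]_p%:E[EFin \o (fun w => Y k.+1 ord_max w *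
        form (fun i => drop_last (Y i)) k (slice b k.+1) w)%R]
      <= (M ord_max * C * Num.sqrt (sqnorm k (slice b k.+1)))%:E)%E.
  move=> kN; have [mY _ _ YM] := hY k ord_max kN.
  have eqq : d.+2%:R * p = d.+1%:R * (p * c).
    by rewrite /c -[d.+2%:R]natr1; field; rewrite gt_eqF.
  have hY' := difference_family_drop (ltnW kN) eqq hY.
  have Zk := IHd k (p * c) (drop_last M) _ (slice b k.+1) pc4 (fun m => M0 _) hY'.
  rewrite -mulrA; apply: Lnorm_mul Zk => //.
  - exact: sub_measurableW mY.
  - exact: sub_measurableW (form_sub_measurable _ hY').
  - by rewrite mulr_ge0 ?sqrtr_ge0.
  - by rewrite natr1.
apply: le_trans (Lnorm_form_rec p4 _ hY step) _; first by rewrite mulr_ge0.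
rewrite lee_fin; apply: ler_wpM2r; first exact: sqrtr_ge0.
rewrite gammaS// (bigD1_ord ord_max)//= -/c.
set Q := \prod_(i < d.+1) M _.
have Q0 : 0 <= Q by rewrite prodr_ge0.
rewrite /C -/Q.
have h1 := sqrt_le_K_Os_rate p4.
have h2 := rate_scale d.+1 p4 c1.
have -> : Num.sqrt (4 * p) * (M ord_max * (gamma d.+1 *
    ((p * c) ^+ d.+1 / ln (p * c) ^+ d.+1) * Q)) =
  (M ord_max * Q * gamma d.+1) *
  (Num.sqrt (4 * p) * ((p * c) ^+ d.+1 / ln (p * c) ^+ d.+1)) by ring.
have -> : gamma d.+1 * K_Os * c ^+ d.+1 * (p ^+ d.+2 / ln p ^+ d.+2) *
    (M ord_max * Q) =
  (M ord_max * Q * gamma d.+1) *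
  (K_Os * (p / ln p) * (c ^+ d.+1 * (p ^+ d.+1 / ln p ^+ d.+1))).
  rewrite [p ^+ d.+2]exprS [ln p ^+ d.+2]exprS.
  by field; rewrite expf_neq0// gt_eqF.
apply: ler_wpM2l; first by rewrite !mulr_ge0 ?gamma_ge0.
by apply: ler_pM; rewrite ?sqrtr_ge0 ?rate_ge0.
Qed.

End multilinear_form.

(** * Almost everywhere equality and convergence *)

Section almost_everywhere.
Context {disp : measure_display} {T : measurableType disp} {R : realType}.
Variable P : probability T R.
Implicit Types (f g : T -> R) (p C : R).
Local Open Scope ereal_scope.

Lemma Lnorm_ae_eq f g p : measurable_fun setT f -> measurable_fun setT g ->
  {ae P, forall w, f w = g w} ->
  'N[P]_p%:E[EFin \o f] = 'N[P]_p%:E[EFin \o g].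
Proof.
move=> mf mg fg; rewrite unlock; congr (_ `^ _).
apply: ge0_ae_eq_integral => //.
- by apply/measurable_EFinP; exact: measurable_powR_norm.
- by apply/measurable_EFinP; exact: measurable_powR_norm.
- by move=> w _; rewrite lee_fin powR_ge0.
- by move=> w _; rewrite lee_fin powR_ge0.
- by apply: filterS fg => w /= -> _.
Qed.

(** Fatou's lemma is applied to the minorants h_n of |f_n|^p given by the tangent
    at |q|: they are affine in |f_n|, so that their convergence to |q|^p is
    immediate; truncation at 0 makes them nonnegative. *)
Lemma Lnorm_fatou (f : nat -> T -> R) (q : T -> R) p C :
  (1 <= p)%R -> (0 <= C)%R ->
  (forall n, measurable_fun setT (f n)) -> measurable_fun setT q ->
  {ae P, forall w, f n w @[n --> \oo] --> q w} ->
  (forall n, 'N[P]_p%:E[EFin \o f n] <= C%:E) ->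
  'N[P]_p%:E[EFin \o q] <= C%:E.
Proof.
move=> p1 C0 mf mq fq fC; have p0 : (0 < p)%R by lra.
apply/Lnorm_leP => //.
pose h n w : R := (`|q w| `^ p + p * `|q w| `^ (p - 1) * (`|f n w| - `|q w|))%R.
pose g n w : \bar R := (Num.max 0 (h n w))%:E.
have mh n : measurable_fun setT (h n).
  apply: measurable_funD; first exact: measurable_powR_norm.
  apply: measurable_funM.
    by apply: measurable_funM => //; exact: measurable_powR_norm.
  by apply: measurable_funB; exact: measurableT_comp.
have mg n : measurable_fun setT (g n).
  by apply/measurable_EFinP; exact: measurable_maxr.
have g0 n w : setT w -> 0 <= g n w by move=> _; rewrite lee_fin le_max lexx.
have gcvg : {ae P, forall w, limn_einf (g ^~ w) = (`|q w| `^ p)%:E}.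
  apply: filterS fq => w fq.
  have : g n w @[n --> \oo] --> (`|q w| `^ p)%:E.
    apply: cvg_EFin; first exact: nearW.
    rewrite /=.
    have -> : (`|q w| `^ p = Num.max 0 (`|q w| `^ p +
       p * `|q w| `^ (p - 1) * (`|q w| - `|q w|)))%R.
      by rewrite subrr mulr0 addr0 max_r ?powR_ge0.
    apply: (@cvg_comp _ _ _ (fun n => h n w) (fun x => Num.max 0 x)%R); last first.
      exact: (@continuous_max R R (cst 0%R) id _ (@cst_continuous _ _ _ _) (fun=> id)).
    apply: cvgD; first exact: cvg_cst.
    apply: cvgM; first exact: cvg_cst.
    apply: cvgB; last exact: cvg_cst.
    exact: cvg_norm.
  by move=> /cvg_limn_einf_sup[->].
have mlim : measurable_fun setT (fun w => limn_einf (g ^~ w)).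
  rewrite (_ : (fun w => _) = fun w => - limn_esup (fun n => - g n w)); last first.
    apply/funext => w; rewrite -limn_einfN; congr limn_einf.
    by apply/funext => n; rewrite [RHS]oppeK.
  apply: measurableT_comp => //; apply: measurable_fun_limn_esup => n.
  exact: measurableT_comp.
rewrite (@ge0_ae_eq_integral _ _ _ P _ _ (fun w => limn_einf (g ^~ w)))//; last 3 first.
- by apply/measurable_EFinP; exact: measurable_powR_norm.
- move=> w _; rewrite limn_einf_lim; apply: lime_ge; first exact: is_cvg_einfs.
  by apply: nearW => n; apply: le_ereal_inf_tmp => _ [k _ <-]; exact: g0.
- by apply: filterS gcvg => w /= -> _.
apply: (le_trans (fatou P measurableT mg g0)).
rewrite limn_einf_lim; apply: lime_le; first exact: is_cvg_einfs.
apply: nearW => n; apply: (@le_trans _ _ (\int[P]_w g n w)).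
  by apply: ereal_inf_lbound; exists n => //=.
have /(Lnorm_leP _ _ p0 C0) := fC n; apply: le_trans.
apply: ge0_le_integral => //.
- by move=> w _; exact: g0.
- by apply/measurable_EFinP; exact: measurable_powR_norm.
move=> w _; rewrite lee_fin ge_max powR_ge0/=.
exact: powR_tangent.
Qed.

End almost_everywhere.

(** * Adapted versions and unit arrays *)

Section versions.
Context {disp : measure_display} {T : measurableType disp} {R : realType}.
Variables (P : probability T R) (F : nat -> set_system T).
Variables (n : option nat) (d : nat) (xi : nat -> 'I_d -> {RV P >-> R}).
Hypothesis hF : filtration F.
Hypothesis hxi : martingale_differences F n xi.

(** The version of E[xi(i,m) | F(i)] has the same integrals as xi(i,m) over the
    events of F(i), hence over those of F(i-1), where they vanish because
    E[xi(i,m) | F(i-1)] = 0. *)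
Lemma adapted_version i m : time_in n i ->
  exists Y : T -> R, [/\ sub_measurable (F i) Y,
    P.-integrable setT (EFin \o Y),
    forall A, F i.-1 A -> (\int[P]_(w in A) (Y w)%:E = 0)%E &
    {ae P, forall w, Y w = xi i m w}].
Proof.
move=> ti; have [ixi _ past [Y [Gm iY IY] Yxi]] := hxi m ti.
have i0 : (0 < i)%N by have /andP[] := ti.
have [_ sF FS Fm] := hF.
exists Y; split=> //; first exact/sub_measurableP.
move=> A FA; have FiA : F i A by rewrite -(prednK i0); exact: FS.
rewrite IY//.
have [|Z [_ iZ IZ] Z0] := past i.-1; first by rewrite prednK.
rewrite -IZ// (@ae_eq_integral _ _ _ P A (cst 0)) ?integral0//.
- exact: Fm FA.
- exact: measurable_funS (measurable_int _ iZ).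
- by apply: filterS Z0 => w /= -> _.
Qed.

Lemma adapted_versions : exists Y : nat -> 'I_d -> T -> R,
  (forall i m, time_in n i ->
    [/\ sub_measurable (F i) (Y i m), P.-integrable setT (EFin \o Y i m) &
        forall A, F i.-1 A -> (\int[P]_(w in A) (Y i m w)%:E = 0)%E]) /\
  {ae P, forall w i m, time_in n i -> Y i m w = xi i m w}.
Proof.
have : forall im : nat * 'I_d, exists Y : T -> R, time_in n im.1 ->
   [/\ sub_measurable (F im.1) Y, P.-integrable setT (EFin \o Y),
    forall A, F im.1.-1 A -> (\int[P]_(w in A) (Y w)%:E = 0)%E &
    {ae P, forall w, Y w = xi im.1 im.2 w}].
  move=> [i m] /=; have [ti|ti] := boolP (time_in n i).
    by have [Y hY] := adapted_version m ti; exists Y.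
  by exists (cst 0).
move=> /choice[Y hY]; exists (fun i m => Y (i, m)); split=> [i m ti|].
  by have [] := hY (i, m) ti.
apply: ae_foralln => i; apply: filter_forall => m.
have [ti|/negbTE ti] := boolP (time_in n i); last exact: nearW.
by have [_ _ _] := hY (i, m) ti; apply: filterS => w /= -> _.
Qed.

Lemma Qfin_form (Y : nat -> 'I_d -> T -> R) N (b : {ffun 'I_d -> nat} -> R) w :
  (forall i, time_in (Some N) i -> time_in n i) ->
  (forall i m, time_in n i -> Y i m w = xi i m w) ->
  Qfin xi N b w = form Y N b w.
Proof.
move=> Nn Yxi; apply: eq_fsbigr => i; rewrite inE => -[ti _].
by congr (_ * _); apply: eq_bigr => s _; rewrite Yxi//; exact: Nn.
Qed.

Lemma sqnorm_unit N (b : {ffun 'I_d -> nat} -> R) :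
  (forall i, time_in (Some N) i -> time_in n i) ->
  unit_arrays n b -> sqnorm N b <= 1.
Proof.
move=> Nn [_ b1]; rewrite -lee_fin.
set s := (\esum_(i in multi_index d n) ((b i) ^+ 2)%:E)%E in b1.
have s0 : (0 <= s)%E by apply: esum_ge0 => i _; rewrite lee_fin sqr_ge0.
have <- : s = 1%E.
  have := congr1 (fun x => x `^ 2)%E b1.
  by rewrite -poweRrM mulVf// poweRe1// poweR1r.
apply: esum_ge; exists (multi_index d (Some N)).
  split; first exact: finite_multi_index.
  by move=> i [ti inc]; split=> // k; exact: Nn.
by rewrite -fsumEFin//; exact: finite_multi_index.
Qed.

(** On the horizon 0 there is no multi-index, so every array has norm 0. *)
Lemma unit_arrays_time (b : {ffun 'I_d -> nat} -> R) : (1 <= d)%N ->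
  unit_arrays n b -> time_in n 1.
Proof.
case: n => [[|k]|]//.
case: d b => // e b _ [_]; rewrite /array_norm multi_index_empty esum_set0.
by rewrite poweR0r ?invr_neq0// => /eqP; rewrite eq_sym onee_eq0.
Qed.

End versions.

Lemma prode_fin_gt0 {R : realType} d (f : 'I_d -> \bar R) :
  (forall m, 0 < f m)%E -> (\prod_(m < d) f m < +oo)%E ->
  forall m, f m \is a fin_num.
Proof.
move=> f0 fy m; rewrite ge0_fin_numE ?ltW// ltey; apply/eqP => fm.
move: fy; rewrite (bigD1 m)//= fm gt0_mulye// big_seq_cond.
by apply: (big_ind (fun x => 0 < x)%E) => // x y; exact: mule_gt0.
Qed.

(** * The main theorem *)

Theorem theorem2p1 (R : realType) (disp : measure_display)
    (T : measurableType disp) (P : probability T R)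
    (F : nat -> set_system T) (hF : filtration F)
    (n : option nat) (d : nat) (hd : (1 <= d)%N)
    (xi : nat -> 'I_d -> {RV P >-> R})
    (hxi : martingale_differences F n xi)
    (p : R) (hp : 4 <= p) (hV : (V xi p n < +oo)%E) :
  (U xi p n <= (gamma d * (p ^+ d / ln p ^+ d))%:E * V xi p n)%E.
Proof.
apply: ge_ereal_sup => _ [b [q [ub isq ->]]].
have t1 := unit_arrays_time hd ub.
have c0 : 0 <= gamma d * (p ^+ d / ln p ^+ d) :> R.
  by rewrite mulr_ge0 ?gamma_ge0 ?rate_ge0.
have dp0 : 0 < d%:R * p by rewrite mulr_gt0 ?ltr0n//; lra.
have mu_ub i m : time_in n i ->
    ('N[P]_(d%:R * p)%:E[EFin \o xi i m] <= mu xi n m (d%:R * p))%E.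
  by move=> ti; apply: ereal_sup_ubound; exists i.
have mu0 m : (0 <= mu xi n m (d%:R * p))%E.
  by apply: le_trans (mu_ub 1%N m t1); exact: Lnorm_ge0.
have V0 : (0 <= V xi p n)%E by apply: prode_ge0 => m _; exact: mu0.
(* If some supremum is 0, then V does not control the other ones, but the
   corresponding factor of Q vanishes almost surely. *)
have [[m mum]|mu_neq0] := pselect (exists m, mu xi n m (d%:R * p) = 0%E).
  have xi0 : {ae P, forall w i, time_in n i -> xi i m w = 0}.
    apply: ae_foralln => i; have [ti|/negbTE ti] := boolP (time_in n i); last first.
      exact: nearW.
    have : ('N[P]_(d%:R * p)%:E[EFin \o xi i m] = 0)%E.
      by apply/eqP; rewrite eq_le Lnorm_ge0 andbT -mum mu_ub.
    have mx : measurable_fun setT (EFin \o xi i m) by exact/measurable_EFinP.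
    move=> /(Lnorm_eq0_eq0 mx); rewrite lte_fin => /(_ dp0).
    by apply: filterS => w /= /(_ I)[] ->.
  have Qfin0 w N : (forall i, time_in (Some N) i -> time_in n i) ->
      (forall i, time_in n i -> xi i m w = 0) -> Qfin xi N b w = 0.
    move=> Nn xiw; apply: fsbig1 => i [ti _].
    by rewrite /xi_prod (bigD1 m)//= xiw ?mul0r ?mulr0//; exact: Nn.
  have q0 : {ae P, forall w, q w = cst 0 w}.
    move: isq; rewrite /is_Q; case En : n => [N|] isq.
      apply: filterS xi0 => w xiw; rewrite isq; apply: Qfin0 xiw.
      by rewrite En.
    apply: filterS2 isq xi0 => w qw xiw; apply: (cvg_unique _ qw) => //.
    rewrite (_ : (fun N => _) = cst 0); first exact: cvg_cst.
    apply/funext => N; apply: Qfin0 xiw => i.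
    by rewrite En => /andP[i0 _]; rewrite /time_in i0.
  rewrite (@Lnorm_ae_eq _ _ _ P q (cst 0))// Lnorm0; last by rewrite eqe gt_eqF//; lra.
  by rewrite mule_ge0// lee_fin.
have mu_fin m : mu xi n m (d%:R * p) \is a fin_num.
  apply: (@prode_fin_gt0 _ _ (fun m => mu xi n m (d%:R * p))) => // k.
  by rewrite lt_def mu0 andbT; apply/eqP => muk; apply: mu_neq0; exists k.
pose M m := fine (mu xi n m (d%:R * p)).
have M0 m : 0 <= M m by exact: fine_ge0.
have -> : V xi p n = (\prod_(m < d) M m)%:E.
  by rewrite -prodEFin; apply: eq_bigr => m _; rewrite fineK.
rewrite -EFinM.
have [Y [hY Yxi]] := adapted_versions hF hxi.
have sF i : sigma_algebra setT (F i) by case: hF.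
have Fm i : F i `<=` measurable by case: hF.
have hYN N : (forall i, time_in (Some N) i -> time_in n i) ->
    difference_family P F N (d%:R * p) M Y.
  move=> Nn i m iN; have ti : time_in n i.+1 by exact: Nn.
  have [mY iY Y0] := hY i.+1 m ti; split=> //.
  rewrite (@Lnorm_ae_eq _ _ _ P (Y i.+1 m) (xi i.+1 m)).
  - by rewrite fineK// mu_ub.
  - exact: sub_measurableW mY.
  - by [].
  - by apply: filterS Yxi => w; apply.
have B0 : 0 <= gamma d * (p ^+ d / ln p ^+ d) * \prod_(m < d) M m.
  by apply: mulr_ge0 => //; exact: prodr_ge0.
have bound N : (forall i, time_in (Some N) i -> time_in n i) ->
    measurable_fun setT (form Y N b) /\
    ('N[P]_p%:E[EFin \o form Y N b] <=
      (gamma d * (p ^+ d / ln p ^+ d) * \prod_(m < d) M m)%:E)%E.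
  move=> Nn; split.
    exact: sub_measurableW (form_sub_measurable hF b (hYN N Nn)).
  apply: le_trans (Lnorm_form hF b hd hp M0 (hYN N Nn)) _.
  rewrite lee_fin ler_piMr//.
  by rewrite -[leRHS]sqrtr1 ler_wsqrtr// (sqnorm_unit Nn ub).
move: isq; rewrite /is_Q; case En : n => [N|] isq.
  have NN i : time_in (Some N) i -> time_in n i by rewrite En.
  have [mf bN] := bound N NN.
  rewrite (@Lnorm_ae_eq _ _ _ P q (form Y N b))//.
  apply: filterS Yxi => w Yw; rewrite isq; exact: Qfin_form Yw.
have NN N i : time_in (Some N) i -> time_in n i.
  by rewrite En => /andP[i0 _]; rewrite /time_in i0.
apply: (Lnorm_fatou (f := fun N => form Y N b)) => //.
- lra.
- by move=> N; have [] := bound N (NN N).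
- apply: filterS2 isq Yxi => w + Yw; apply: cvg_trans.
  by apply: near_eq_cvg; apply: nearW => N; rewrite (Qfin_form b (NN N) Yw).
- by move=> N; have [] := bound N (NN N).
Qed.
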